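(* For every positive integer $n$ there is a simple graph $H_n$ on $n$ vertices such that $$q_1(H_n)\,q_1(\overline{H_n})=\frac{5}{18}\left(4+\sqrt{14}\right)n^2+O(n),$$ that is, there exist a constant $C>0$ and graphs $H_n$ on $n$ vertices ($n\ge1$) such that $\left|q_1(H_n)\,q_1(\overline{H_n})-\frac{5}{18}(4+\sqrt{14})\,n^2\right|\le Cn$ for all $n\ge 1$.
   Context: $\overline{H}$ denotes the complement of a graph $H$. For a graph $H$ with adjacency matrix $A(H)$ and diagonal degree matrix $D(H)$, $q_1(H)$ denotes the largest eigenvalue of the signless Laplacian matrix $Q(H)=A(H)+D(H)$. *)

(* Defs.v *)
From mathcomp Require Import all_boot all_order all_algebra.
From mathcomp Require Import classical_sets reals.
From mathcomp Require complex polyrcf.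

Set Implicit Arguments.
Unset Strict Implicit.
Unset Printing Implicit Defensive.

Import Order.TTheory GRing.Theory Num.Theory.

Local Open Scope ring_scope.

Record sgraph (n : nat) := SGraph {
  adj : rel 'I_n;
  adj_sym : symmetric adj;
  adj_irr : irreflexive adj
}.

Section Complement.
Variables (n : nat) (G : sgraph n).

Definition compl_adj : rel 'I_n := fun x y => (x != y) && ~~ adj G x y.

Lemma compl_adj_sym : symmetric compl_adj.
Proof. by move=> x y; rewrite /compl_adj eq_sym adj_sym. Qed.

Lemma compl_adj_irr : irreflexive compl_adj.
Proof. by move=> x; rewrite /compl_adj eqxx. Qed.

Definition compl : sgraph n := SGraph compl_adj_sym compl_adj_irr.

End Complement.

Definition degree (n : nat) (G : sgraph n) (i : 'I_n) : nat :=
  #|[set j | adj G i j]|.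

Definition adjmx (R : realType) (n : nat) (G : sgraph n) : 'M[R]_n :=
  \matrix_(i, j) (adj G i j)%:R.

Definition degmx (R : realType) (n : nat) (G : sgraph n) : 'M[R]_n :=
  diag_mx (\row_i (degree G i)%:R).

Definition signless_laplacian (R : realType) (n : nat) (G : sgraph n) :
    'M[R]_n :=
  adjmx R G + degmx R G.

(* The supremum is attained when 0 < n: see q1_eigenvalue and q1_max. *)
Definition q1 (R : realType) (n : nat) (G : sgraph n) : R :=
  sup [set a : R | eigenvalue (signless_laplacian R G) a]%classic.

Section LargestEigenvalue.
Variable R : realType.

Lemma signless_laplacian_sym n (G : sgraph n) :
  (signless_laplacian R G)^T = signless_laplacian R G.
Proof.
rewrite /signless_laplacian /degmx linearD /= tr_diag_mx; congr (_ + _).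
by apply/matrixP => i j; rewrite !mxE adj_sym.
Qed.

Import complex.
Local Open Scope complex_scope.

Lemma symmetric_eigenvalue n (A : 'M[R]_n) :
  (0 < n)%N -> A^T = A -> exists a : R, eigenvalue A a.
Proof.
move=> n_gt0 A_sym; pose f := real_complex R.
have [z /eigenvalueP [v vA v_neq0]] := eigenvalue_closed (map_mx f A) n_gt0.
pose w : 'cV[R[i]]_n := (map_mx Num.conj v)^T.
have Aw : map_mx f A *m w = Num.conj z *: w.
  rewrite /w -[in LHS]A_sym -matrix.map_trmx -trmx_mul -linearZ /=; congr _^T.
  rewrite (_ : map_mx f A = map_mx Num.conj (map_mx f A)); last first.
    by apply/matrixP => i j; rewrite !mxE /= /Num.conj /= oppr0.
  by rewrite -map_mxM vA map_mxZ.
have vw_neq0 : (v *m w) 0 0 != 0.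
  apply: contra v_neq0; rewrite mxE psumr_eq0 => [/allP vw0|i _]; last first.
    by rewrite !mxE mul_conjC_ge0.
  apply/eqP/rowP => i; rewrite mxE; apply/eqP.
  by have := vw0 i (mem_index_enum i); rewrite !mxE mul_conjC_eq0.
have z_real : Num.conj z = z.
  apply: (mulIf vw_neq0).
  have /matrixP/(_ 0 0) : v *m (map_mx f A *m w) = (v *m map_mx f A) *m w.
    by rewrite mulmxA.
  by rewrite Aw vA -scalemxAr -scalemxAl !mxE.
have Re_z : real_complex R (complex.Re z) = z.
  case: z z_real {vA Aw} => x y /= [] /eqP.
  by rewrite eq_sym -subr_eq0 opprK -mulr2n mulrn_eq0 /= => /eqP ->.
exists (complex.Re z); rewrite eigenvalue_root_char.
rewrite -(fmorph_root f) map_char_poly -eigenvalue_root_char.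
by apply/eigenvalueP; exists v => //; rewrite vA -[in LHS]Re_z.
Qed.

Lemma sup_eigenvalue n (A : 'M[R]_n) (S := [set a : R | eigenvalue A a]%classic) :
  (0 < n)%N -> A^T = A ->
  eigenvalue A (sup S) /\ forall a, eigenvalue A a -> a <= sup S.
Proof.
move=> n_gt0 /(symmetric_eigenvalue n_gt0) [a Aa].
have pA0 : char_poly A != 0 by rewrite monic_neq0 ?char_poly_monic.
have memS x : (x \in polyrcf.rootsR (char_poly A)) = eigenvalue A x.
  by rewrite eigenvalue_root_char -polyrcf.roots_on_rootsR // in_itv.
pose s := polyrcf.rootsR (char_poly A).
have [m Am m_max] : exists2 m, eigenvalue A m & forall x, eigenvalue A x -> x <= m.
  have : a \in s by rewrite memS.
  have : {subset s <= eigenvalue A} by move=> x; rewrite memS.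
  have : forall x, eigenvalue A x -> x \in s by move=> x; rewrite memS.
  move=> sA As a_s.
  exists (\big[Num.max/a]_(x <- s) x).
    rewrite big_seq; apply: (big_ind (fun x => eigenvalue A x)) => [|x y ex ey|x].
    - exact: Aa.
    - by case: leP.
    - exact: As.
  by move=> x /sA xs; apply: (@le_bigmax_seq _ _ _ _ _ _ xpredT).
have -> : sup S = m; last by [].
apply/eqP; rewrite eq_le; apply/andP; split.
  by apply: ge_sup; [exists a | exact: m_max].
by apply: ub_le_sup => //; exists m; exact: m_max.
Qed.

Lemma q1_eigenvalue n (G : sgraph n) :
  (0 < n)%N -> eigenvalue (signless_laplacian R G) (q1 R G).
Proof. by move=> /sup_eigenvalue/(_ (signless_laplacian_sym G)) []. Qed.

Lemma q1_max n (G : sgraph n) (a : R) :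
  (0 < n)%N -> eigenvalue (signless_laplacian R G) a -> a <= q1 R G.
Proof. by move=> /sup_eigenvalue/(_ (signless_laplacian_sym G)) [_]; apply. Qed.

End LargestEigenvalue.

(* Main.v *)
Require Import Defs.
From mathcomp Require Import all_boot all_order all_algebra.
From mathcomp Require Import reals.
From mathcomp Require Import ring lra zify.

Import Order.TTheory GRing.Theory Num.Theory.

Local Open Scope ring_scope.

(** The graphs are complete split graphs: a clique on k vertices, each of them
    also joined to all of the remaining n - k vertices, which are pairwise
    non-adjacent. The complement is a clique on n - k vertices together with k
    isolated vertices, so its largest signless Laplacian eigenvalue is
    2 (n - k - 1). On vectors that are constant on the two classes of the split
    graph, Q acts as a 2 by 2 matrix with characteristic polynomial
    x^2 - (n + 2 k - 2) x + 2 k (k - 1), whose larger root is [split_root].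
    With k = sigma n the product of the two eigenvalues is, to leading order,
      (1 - sigma) (1 + 2 sigma + sqrt (1 + 4 sigma - 4 sigma^2)) n^2,
    and sigma = 1/6 turns this into (5/18) (4 + sqrt 14) n^2. Rounding n/6 to an
    integer k moves each eigenvalue by a bounded amount only, and both
    eigenvalues are O(n), so the product moves by O(n).

    Both eigenvalues are identified by [q1_eq]. An explicit eigenvector gives
    the lower bound. The upper bound is the easy half of Perron-Frobenius
    theory, [eigenvalue_le_of_positive_vector]: a positive vector v with
    v Q <= r v forces every eigenvalue of the nonnegative matrix Q to be at
    most r. *)

(** * Certifying the largest signless Laplacian eigenvalue *)

(** The Collatz-Wielandt upper bound. Measure an eigenvector u against v: at an
    index m where |u_m| / v_m is largest, the eigenvalue equation and the
    triangle inequality give |a| |u_m| <= r |u_m|. *)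
Lemma eigenvalue_le_of_positive_vector (R : realType) (n : nat) (A : 'M[R]_n)
    (v : 'rV[R]_n) (r a : R) :
  (forall i j, 0 <= A i j) -> (forall j, 0 < v 0 j) ->
  (forall j, (v *m A) 0 j <= r * v 0 j) -> eigenvalue A a -> a <= r.
Proof.
move=> A_ge0 v_gt0 vA_le /eigenvalueP [u uA /rV0Pn [j0 uj0]].
pose ratio (j : 'I_n) := `|u 0 j| / v 0 j.
have [m _ m_max] := @arg_maxP _ _ _ j0 xpredT ratio isT.
have u_le i : `|u 0 i| <= ratio m * v 0 i.
  by rewrite -ler_pdivrMr //; exact: m_max.
have ratio_gt0 : 0 < ratio m.
  by apply: lt_le_trans (m_max j0 isT); rewrite divr_gt0 ?normr_gt0.
have abs_um : `|u 0 m| = ratio m * v 0 m by rewrite divfK ?gt_eqF.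
have : `|a| * `|u 0 m| <= ratio m * (r * v 0 m).
  rewrite -normrM; have -> : a * u 0 m = (u *m A) 0 m by rewrite uA mxE.
  apply: le_trans (ler_wpM2l (ltW ratio_gt0) (vA_le m)).
  rewrite !mxE mulr_sumr; apply: le_trans (ler_norm_sum _ _ _) _.
  apply: ler_sum => i _.
  by rewrite normrM (ger0_norm (A_ge0 i m)) mulrA ler_wpM2r.
rewrite mulrCA -abs_um ler_pM2r; last by rewrite abs_um mulr_gt0.
exact/le_trans/ler_norm.
Qed.

(** Each edge ij contributes v_i + v_j to coordinate j, the second term coming
    from the degree matrix; eigenvector computations thereby become sums over
    neighbourhoods. *)
Lemma mul_signless_laplacian (R : realType) (n : nat) (G : sgraph n)
    (v : 'rV[R]_n) (j : 'I_n) :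
  (v *m signless_laplacian R G) 0 j = \sum_(i | adj G j i) (v 0 i + v 0 j).
Proof.
rewrite mulmxDr mul_mx_diag !mxE big_split /= sumr_const; congr (_ + _).
  rewrite [RHS]big_mkcond; apply: eq_bigr => i _ /=.
  by rewrite mxE adj_sym; case: (adj G j i); rewrite ?mulr1 ?mulr0.
by rewrite mulr_natr /degree cardsE.
Qed.

(** Two vectors are used because an eigenvector w for the largest eigenvalue
    need not be positive when the graph is disconnected; v then supplies the
    upper bound. *)
Lemma q1_eq (R : realType) (n : nat) (G : sgraph n) (v w : 'rV[R]_n) (r : R) :
  (forall j, 0 < v 0 j) ->
  (forall j, \sum_(i | adj G j i) (v 0 i + v 0 j) <= r * v 0 j) ->
  w != 0 ->
  (forall j, \sum_(i | adj G j i) (w 0 i + w 0 j) = r * w 0 j) ->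
  q1 R G = r.
Proof.
move=> v_gt0 v_super w_neq0 w_eigen.
have n_gt0 : (0 < n)%N by case/rV0Pn: w_neq0 => i _; apply: leq_ltn_trans (ltn_ord i).
apply/eqP; rewrite eq_le; apply/andP; split.
  apply: (@eigenvalue_le_of_positive_vector _ _ (signless_laplacian R G) v) => //.
  - move=> i j; rewrite !mxE addr_ge0 ?ler0n //.
    by case: (i == j); rewrite ?mulr1n ?mulr0n ?ler0n.
  - by move=> j; rewrite mul_signless_laplacian.
  - exact: q1_eigenvalue.
apply: q1_max => //; apply/eigenvalueP; exists w => //.
by apply/rowP => j; rewrite mul_signless_laplacian w_eigen mxE.
Qed.

(** * Complete split graphs *)

Section CompleteSplit.
Variables (n k : nat).

Definition split_adj : rel 'I_n :=
  fun i j => (i != j) && ((i < k)%N || (j < k)%N).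

Lemma split_adj_sym : symmetric split_adj.
Proof. by move=> i j; rewrite /split_adj eq_sym orbC. Qed.

Lemma split_adj_irr : irreflexive split_adj.
Proof. by move=> i; rewrite /split_adj eqxx. Qed.

Definition complete_split : sgraph n := SGraph split_adj_sym split_adj_irr.

Lemma split_adj_clique (i j : 'I_n) : (j < k)%N -> split_adj j i = (i != j).
Proof. by move=> jk; rewrite /split_adj jk andbT eq_sym. Qed.

Lemma split_adj_indep (i j : 'I_n) : (k <= j)%N -> split_adj j i = (i < k)%N.
Proof.
rewrite leqNgt /split_adj => /negbTE jk; rewrite jk /=.
by case: eqP => // <-; rewrite jk.
Qed.

Lemma compl_split_adj (i j : 'I_n) :
  adj (compl complete_split) j i = [&& (k <= j)%N, (k <= i)%N & i != j].
Proof.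
rewrite /= /compl_adj /= /split_adj eq_sym !(leqNgt k).
by case: (i != j); rewrite ?andbF //= negb_or !andbT.
Qed.

Variable R : realType.
Hypothesis kn : (k < n)%N.

Lemma sum_clique (c : R) : \sum_(i < n | (i < k)%N) c = k%:R * c.
Proof. by rewrite (big_ord_narrow (ltnW kn)) sumr_const card_ord mulr_natl. Qed.

Lemma sum_indep (c : R) : \sum_(i < n | (k <= i)%N) c = (n%:R - k%:R) * c.
Proof.
have : \sum_(i < n) c = n%:R * c by rewrite sumr_const card_ord mulr_natl.
rewrite (bigID (fun i : 'I_n => (i < k)%N)) /= sum_clique.
under [in X in _ + X = _]eq_bigl => i do rewrite -leqNgt.
by move=> eq_n; rewrite mulrBl -eq_n addrC addKr.
Qed.

(** The all-ones vector gives the upper bound, since its image under Q is twice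
    the degree sequence; the indicator of the independent class of the split
    graph, a clique of the complement, is an eigenvector. *)
Lemma q1_compl_complete_split :
  q1 R (compl complete_split) = 2 * (n%:R - k%:R - 1).
Proof.
have kn_le : k%:R + 1 <= n%:R :> R by rewrite natr1 ler_nat.
have sum_other (j : 'I_n) : (k <= j)%N ->
    \sum_(i < n | (k <= i)%N && (i != j)) 2 = 2 * (n%:R - k%:R - 1) :> R.
  by move=> kj; have := sum_indep 2; rewrite (bigD1 j) //= => /(canRL (addKr _)) ->; ring.
pose v : 'rV[R]_n := \row_i 1; pose w : 'rV[R]_n := \row_i (k <= i)%N%:R.
apply: (@q1_eq _ _ _ v w).
- by move=> j; rewrite mxE ltr01.
- move=> j; under eq_bigl => i do rewrite compl_split_adj.
  rewrite mxE mulr1; case: (leqP k j) => [kj|_] /=; last first.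
    by rewrite big_pred0_eq; lra.
  by rewrite -(sum_other j kj); apply/ler_sum => i _; rewrite mxE.
- by apply/rV0Pn; exists (Ordinal kn); rewrite mxE leqnn oner_eq0.
- move=> j; under eq_bigl => i do rewrite compl_split_adj.
  rewrite mxE; case: (leqP k j) => [kj|_] /=; last by rewrite big_pred0_eq mulr0.
  rewrite mulr1 -(sum_other j kj); apply/eq_bigr => i /andP[ki _].
  by rewrite mxE ki.
Qed.

(** The discriminant of x^2 - (n + 2 k - 2) x + 2 k (k - 1), arranged so that
    its nonnegativity is visible. *)
Definition split_disc : R := (n%:R - 2) ^+ 2 + 4 * k%:R * (n%:R - k%:R).

Definition split_root : R := (n%:R + 2 * k%:R - 2 + Num.sqrt split_disc) / 2.

Lemma split_disc_ge0 : 0 <= split_disc.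
Proof.
by rewrite addr_ge0 ?sqr_ge0 // !mulr_ge0 ?ler0n ?subr_ge0 ?ler_nat // ltnW.
Qed.

(** The vector equal to r - k on the clique and to k elsewhere is an
    eigenvector for any root r of the quadratic; for the larger root it is
    positive, so the same vector serves for both bounds. *)
Lemma q1_complete_split : (0 < k)%N -> q1 R complete_split = split_root.
Proof.
move=> k_gt0; set r := split_root.
have k_ge1 : 1 <= k%:R :> R by rewrite ler1n.
have kn_le : k%:R + 1 <= n%:R :> R by rewrite natr1 ler_nat.
have sqr_disc : Num.sqrt split_disc ^+ 2 = split_disc.
  exact/sqr_sqrtr/split_disc_ge0.
(* The quadratic in the form of the eigenvalue equation at a clique vertex. *)
have r_eq : r * (r - k%:R)
    = (n%:R + k%:R - 2) * (r - k%:R) + (n%:R - k%:R) * k%:R.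
  have E : (2 * r - (n%:R + 2 * k%:R - 2)) ^+ 2 = split_disc.
    by rewrite -sqr_disc; congr (_ ^+ 2); rewrite /r /split_root; field.
  move: E; rewrite /split_disc => E; nra.
have r_gt : k%:R < r.
  have disc_gt0 : 0 < Num.sqrt split_disc.
    rewrite sqrtr_gt0 /split_disc ltr_wpDl ?sqr_ge0 // !mulr_gt0 //; lra.
  by rewrite /r /split_root; lra.
pose v : 'rV[R]_n := \row_i if (i < k)%N then r - k%:R else k%:R.
have v_eigen j : \sum_(i | adj complete_split j i) (v 0 i + v 0 j) = r * v 0 j.
  rewrite [v 0 j]mxE /=; case: ltnP => jk.
    under eq_bigl => i do rewrite split_adj_clique //.
    set x := r - k%:R.
    have sum_v : \sum_i v 0 i = k%:R * x + (n%:R - k%:R) * k%:R.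
      rewrite (bigID (fun i : 'I_n => (i < k)%N)) /= -sum_clique -sum_indep.
      congr (_ + _); first by under eq_bigr => i ik do rewrite mxE ik.
      under [RHS]eq_bigl => i do rewrite leqNgt.
      by apply: eq_bigr => i /negbTE ik; rewrite mxE ik.
    have : \sum_i (v 0 i + x) = k%:R * x + (n%:R - k%:R) * k%:R + n%:R * x.
      by rewrite big_split /= sum_v sumr_const card_ord -(mulr_natl x).
    rewrite (bigD1 j) //= [v 0 j]mxE jk -/x r_eq -/x => /(canRL (addKr _)) ->.
    by ring.
  under eq_bigl => i do rewrite split_adj_indep //.
  transitivity (\sum_(i < n | (i < k)%N) r); last by rewrite sum_clique mulrC.
  by apply: eq_bigr => i ik; rewrite mxE ik subrK.
apply: (@q1_eq _ _ _ v v) => //.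
- by move=> j; rewrite mxE; case: ifP => _; lra.
- by move=> j; rewrite v_eigen.
- apply/rV0Pn; exists (Ordinal kn); rewrite mxE ltnn.
  by rewrite gt_eqF //; lra.
Qed.

End CompleteSplit.

(** * Asymptotics for a clique of about n/6 vertices *)

Lemma dist_sqrt_mul_le (R : realType) (a b : R) :
  0 <= a -> 0 <= b -> `|Num.sqrt a - b| * b <= `|a - b ^+ 2|.
Proof.
move=> a_ge0 b_ge0; rewrite -[in leRHS](sqr_sqrtr a_ge0) subr_sqr normrM.
by rewrite ler_wpM2l // ger0_norm ?addr_ge0 ?sqrtr_ge0 // lerDr sqrtr_ge0.
Qed.

(** Write k = n/6 + e with |e| <= 1. The discriminant is 14 n^2 / 9 + O(n),
    so its square root is (sqrt 14 / 3) n + O(1): dividing by a quantity of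
    order n costs one power of n. *)
Lemma split_root_approx (R : realType) (n k : nat) :
  (0 < n)%N -> (k < n)%N -> (n <= 6 * k + 1)%N -> (6 * k <= n + 4)%N ->
  `|split_root n k R - (4 + Num.sqrt 14) / 6 * n%:R| <= 10.
Proof.
move=> n_gt0 kn n_le k_le.
have N1 : 1 <= n%:R :> R by rewrite ler1n.
have nk : n%:R <= 6 * k%:R + 1 :> R by rewrite -natrM natr1 ler_nat -addn1.
have kN : 6 * k%:R <= n%:R + 4 :> R by rewrite -natrM -natrD ler_nat.
have s14 : Num.sqrt 14 ^+ 2 = 14 :> R by rewrite sqr_sqrtr.
have s14_ge : 3 <= Num.sqrt 14 :> R.
  by rewrite -(ler_pXn2r (n := 2)) ?nnegrE ?sqrtr_ge0 // s14; lra.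
have approx : `|Num.sqrt (split_disc n k R) - Num.sqrt 14 / 3 * n%:R| <= 15.
  set s := Num.sqrt 14 in s14 s14_ge *.
  have b_ge : n%:R <= s / 3 * n%:R by rewrite ler_peMl ?ler0n //; lra.
  have b_ge0 : 0 <= s / 3 * n%:R by lra.
  have := dist_sqrt_mul_le _ _ _ (split_disc_ge0 _ _ R kn) b_ge0.
  set d := `|Num.sqrt _ - _| => d_le.
  have dn : d * n%:R <= d * (s / 3 * n%:R) by rewrite ler_wpM2l // normr_ge0.
  have diff : `|split_disc n k R - (s / 3 * n%:R) ^+ 2| <= 15 * n%:R.
    have -> : (s / 3 * n%:R) ^+ 2 = 14 / 9 * n%:R ^+ 2.
      by rewrite -s14; field.
    have -> : split_disc n k R - 14 / 9 * n%:R ^+ 2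
      = (8 / 3 * (k%:R - n%:R / 6) - 4) * n%:R
        + 4 * (1 - (k%:R - n%:R / 6) ^+ 2).
      by rewrite /split_disc; field.
    set e := k%:R - n%:R / 6.
    have e_ge : -1 <= e by rewrite /e; lra.
    have e_le : e <= 1 by rewrite /e; lra.
    by rewrite ler_norml; apply/andP; split; nra.
  rewrite -(ler_pM2r (x := n%:R)) ?ltr0n //.
  exact: le_trans dn (le_trans d_le diff).
move: approx; rewrite /split_root !ler_norml => /andP[lo hi].
by apply/andP; split; lra.
Qed.

Theorem proposition21 (R : realType) :
  exists C : R, 0 < C /\
  exists H : forall n : nat, sgraph n,
  forall n : nat, (0 < n)%N ->
    `|q1 R (H n) * q1 R (compl (H n))
        - 5 / 18 * (4 + Num.sqrt 14) * n%:R ^+ 2| <= C * n%:R.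
Proof.
(* 48 = 10 * 4 + 2 * 4: the error of each factor times a bound, in multiples of
   n, for the other one. *)
exists 48; split; first by [].
(* Rounding n/6 this way keeps 0 < k < n for every n > 1. *)
exists (fun n => complete_split n ((n + 4) %/ 6)) => n n_gt0.
set k := ((n + 4) %/ 6)%N.
have kn : (k < n)%N by rewrite /k; lia.
have n_le : (n <= 6 * k + 1)%N by rewrite /k; lia.
have k_le : (6 * k <= n + 4)%N by rewrite /k; lia.
have prod_eq : q1 R (complete_split n k) * q1 R (compl (complete_split n k))
    = split_root n k R * (2 * (n%:R - k%:R - 1)).
  rewrite q1_compl_complete_split //.
  (* If k = 0 then n = 1, and both products vanish through their second factor. *)
  case: (posnP k) => [k0|k_gt0]; last by rewrite q1_complete_split.
  have -> : n = 1%N by move: n_le; rewrite k0; lia.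
  by rewrite k0 subr0 subrr !mulr0.
rewrite prod_eq.
have := split_root_approx R n k n_gt0 kn n_le k_le.
set r := split_root n k R; set s := Num.sqrt 14.
have N1 : 1 <= n%:R :> R by rewrite ler1n.
have nk : n%:R <= 6 * k%:R + 1 :> R by rewrite -natrM natr1 ler_nat -addn1.
have kN : 6 * k%:R <= n%:R + 4 :> R by rewrite -natrM -natrD ler_nat.
have s_ge0 : 0 <= s by exact: sqrtr_ge0.
have s_le : s <= 4.
  by rewrite -(ler_pXn2r (n := 2)) ?nnegrE // sqr_sqrtr //; lra.
set d := r - _ => d_le.
have -> : r * (2 * (n%:R - k%:R - 1)) - 5 / 18 * (4 + s) * n%:R ^+ 2
  = d * (2 * (n%:R - k%:R - 1))
    + (4 + s) / 6 * n%:R * (2 * (n%:R / 6 - k%:R - 1)).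
  by rewrite /d; field.
have t_le : `|2 * (n%:R - k%:R - 1)| <= 4 * n%:R :> R.
  by rewrite ler_norml; apply/andP; split; lra.
have u_le : `|2 * (n%:R / 6 - k%:R - 1)| <= 4 :> R.
  by rewrite ler_norml; apply/andP; split; lra.
have c_ge0 : 0 <= (4 + s) / 6 * n%:R by rewrite mulr_ge0 //; lra.
have c_le : (4 + s) / 6 * n%:R <= 2 * n%:R by rewrite ler_wpM2r //; lra.
apply: le_trans (ler_normD _ _) _; rewrite (normrM d) (normrM (_ / 6 * _)) (ger0_norm c_ge0).
have := ler_pM (normr_ge0 d) (normr_ge0 _) d_le t_le.
have := ler_pM c_ge0 (normr_ge0 _) c_le u_le.
by lra.
Qed.
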